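(* Let $S$ be a von Neumann regular ring, $V$ an $S$-bimodule, $T=T_S(V)$ the tensor $S$-ring, $n$ a nonnegative integer, $P$ an $S$-subbimodule of $T^{\le n}$, and let $R$ be the graded $S$-subbimodule of $T$ whose only possibly nonzero homogeneous component is $R^n:=p^n(P)$. The $S$-ring $U(P)$ is a PBW-deformation of $A(R)$ if and only if there exists a morphism of filtered $S$-bimodules $\alpha:R\to T$ such that $P=\alpha(R)$ and $P$ is of PBW-type.
   Context: $T=\bigoplus_{m\ge 0}T^m$ is graded with $T^m=V^{\otimes_S m}$, $T^0=S$; $p^m:T\to T^m$ is the projection, $T^{\le m}=\bigoplus_{q\le m}T^q$, $X^{\le m}=X\cap T^{\le m}$, and $\langle X\rangle$ is the two-sided ideal generated by $X$. For an $S$-subbimodule $P\subseteq T$: $R_P^m:=p^m(P^{\le m})$, $R_P:=\bigoplus_m R_P^m$; $U(P):=T/\langle P\rangle$, filtered by $U(P)^{\le m}$ = image of $T^{\le m}$, with associated graded ring $\operatorname{gr}U(P)$. For a graded $S$-subbimodule $R$ of $T$ put $A(R):=T/\langle R\rangle$. If $R\subseteq R_P$, there is a surjective morphism of graded $S$-rings $\Phi_{P,R}:A(R)\to\operatorname{gr}U(P)$, given for $x\in T^m$ by $x+\langle R\rangle\mapsto (x+\langle P\rangle)+U(P)^{\le m-1}$; put $\Phi_P=\Phi_{P,R_P}$. $U(P)$ is a PBW-deformation of $A(R)$ if $\Phi_{P,R}$ is an isomorphism; $P$ is of PBW-type if $\Phi_P$ is an isomorphism. (Here $R\subseteq R_P$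 holds since $R^n=R_P^n$.) A morphism of filtered $S$-bimodules $\alpha:R\to T$ is an $S$-bimodule map with $\alpha(R^m)\subseteq T^{\le m}$ for all $m$, and by convention it is always assumed that its degree-zero component $\alpha_0$ (given by $p^m\alpha$ on $R^m$) is the inclusion $R\subseteq T$. *)

(* Defs.v *)
From HB Require Import structures.
From mathcomp Require Import all_boot all_algebra.
From mathcomp Require Import boolp classical_sets.
From mathcomp Require Import freeg.

Set Implicit Arguments.
Unset Strict Implicit.
Unset Printing Implicit Defensive.

Import GRing.Theory.
Local Open Scope ring_scope.
Local Open Scope quotient_scope.
Local Open Scope classical_set_scope.

Definition von_neumann_regular (S : pzRingType) : Prop :=
  forall a : S, exists x : S, a = a * x * a.

HB.mixin Record Lmodule_isBimodule (S : pzRingType) V of GRing.Lmodule S V := {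
  ract : V -> S -> V;
  ractA : forall v s t, ract (ract v s) t = ract v (s * t);
  ractr1 : forall v, ract v 1 = v;
  ractDl : forall s, {morph ract^~ s : v w / v + w};
  ractDr : forall v, {morph ract v : s t / s + t};
  lractA : forall (s : S) v t, ract (s *: v) t = s *: ract v t
}.

#[short(type="bimodType")]
HB.structure Definition Bimodule (S : pzRingType) :=
  {V of GRing.Lmodule S V & Lmodule_isBimodule S V}.

Definition subgroup (M : zmodType) (A : set M) : Prop :=
  A 0 /\ forall x y, A x -> A y -> A (x - y).

Definition subbimodule (S : pzRingType) (M : bimodType S) (A : set M) : Prop :=
  [/\ subgroup A, (forall s x, A x -> A (s *: x)) &
                  (forall s x, A x -> A (ract x s))].

Section Regular.
Variable S : pzRingType.

HB.instance Definition _ := @Lmodule_isBimodule.Build S S^o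
  (fun v s => v * s) (fun v s t => esym (mulrA v s t)) (@mulr1 S)
  (fun s v w => mulrDl v w s) (fun v s t => mulrDr v s t)
  (fun s v t => esym (mulrA s v t)).
End Regular.

Definition zspan (M : zmodType) (X : set M) : set M :=
  [set x | forall A, subgroup A -> X `<=` A -> A x].

Definition zspan_pred (M : zmodType) (X : set M) : pred M :=
  fun x => `[< zspan X x >].

Section Zspan.
Variables (M : zmodType) (X : set M).

Lemma zspan_gen : X `<=` zspan X.
Proof. by move=> x Xx A _; apply. Qed.

Fact zspan_pred_closed : zmod_closed (zspan_pred X).
Proof.
split=> [|x y /asboolP hx /asboolP hy]; apply/asboolP => A hA XA.
  by case: hA.
by apply hA.2; [apply: hx | apply: hy].
Qed.

HB.instance Definition _ := GRing.isZmodClosed.Build M (zspan_pred X)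
  zspan_pred_closed.

Definition zspan_closed : zmodClosed M :=
  GRing.ZmodClosed.clone M (zspan_pred X) _.
End Zspan.

Lemma quot_eqP (M : zmodType) (I : zmodClosed M) (x y : M) :
  reflect (\pi_(Quotient.quot I) x = \pi y) (x - y \in I).
Proof. by rewrite Quotient.idealrBE; exact: eqP. Qed.

Lemma quot_piD (M : zmodType) (I : zmodClosed M) :
  {morph \pi_(Quotient.quot I) : x y / x + y}.
Proof. exact: raddfD. Qed.

Lemma quot_piB (M : zmodType) (I : zmodClosed M) :
  {morph \pi_(Quotient.quot I) : x y / x - y}.
Proof. exact: raddfB. Qed.

Lemma quot_piN (M : zmodType) (I : zmodClosed M) :
  {morph \pi_(Quotient.quot I) : x / - x}.
Proof. exact: raddfN. Qed.

Lemma quot_piMz (M : zmodType) (I : zmodClosed M) (k : int) :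
  {morph \pi_(Quotient.quot I) : x / x *~ k}.
Proof. by move=> x; rewrite raddfMz. Qed.

Section Tensor.
Variables (S : pzRingType) (M N : bimodType S).

Local Notation free := {freeg (M * N)%type / int}.

Definition tensor_rel : set free := [set t |
  [\/ exists m m' n, t = << (m + m', n) >> - << (m, n) >> - << (m', n) >>,
      exists m n n', t = << (m, n + n') >> - << (m, n) >> - << (m, n') >> |
      exists m s n, t = << (ract m s, n) >> - << (m, s *: n) >>]].

Definition tensor : Type :=
  Quotient.quot (zspan_closed tensor_rel).

HB.instance Definition _ := GRing.Zmodule.on tensor.
HB.instance Definition _ := Quotient.on tensor.

Definition tens (m : M) (n : N) : tensor := \pi_tensor << (m, n) >>.

End Tensor.

Section TensorTheory.
Variables (S : pzRingType) (M N : bimodType S).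
Implicit Types (m : M) (n : N) (t : tensor M N).
Local Notation free := {freeg (M * N)%type / int}.

Lemma tens_rel_eq (x y : free) : tensor_rel (x - y) ->
  \pi_(tensor M N) x = \pi y.
Proof. by move=> h; apply/quot_eqP/asboolP; apply: zspan_gen. Qed.

Lemma tensDl m m' n : tens (m + m') n = tens m n + tens m' n.
Proof.
rewrite /tens -quot_piD; apply: tens_rel_eq.
by constructor 1; exists m, m', n; rewrite opprD addrA.
Qed.

Lemma tensDr m n n' : tens m (n + n') = tens m n + tens m n'.
Proof.
rewrite /tens -quot_piD; apply: tens_rel_eq.
by constructor 2; exists m, n, n'; rewrite opprD addrA.
Qed.

Lemma tens_ract m s n : tens (ract m s) n = tens m (s *: n).
Proof. by apply: tens_rel_eq; constructor 3; exists m, s, n. Qed.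

Lemma tens0l n : tens (0 : M) n = 0.
Proof. by apply: (addIr (tens (0 : M) n)); rewrite -tensDl !add0r. Qed.

Lemma tensNl m n : tens (- m) n = - tens m n.
Proof. by apply: (addIr (tens m n)); rewrite -tensDl !addNr tens0l. Qed.

Lemma tens_ind (K : tensor M N -> Prop) :
  (forall m n, K (tens m n)) -> (forall x y, K x -> K y -> K (x + y)) ->
  forall t, K t.
Proof.
move=> K1 KD; elim/quotW => x.
have K0 : K 0 by rewrite -(tens0l (0 : N)); exact: K1.
have Kk (k : int) (y : M * N) : K (\pi << k *g y >>).
  case: y => m n.
  have KP (i : nat) m' : K (\pi << i%:Z *g (m', n) >>).
    elim: i => [|i IH]; first by rewrite freegU0 raddf0.
    by rewrite -add1n PoszD -freegUD quot_piD; apply: KD => //; exact: K1.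
  case: k => i; first exact: KP.
  have -> : \pi_(tensor M N) << Negz i *g (m, n) >> = \pi << i.+1%:Z *g (- m, n) >>.
    have mulz (u : M) : << i.+1%:Z *g (u, n) >> = << (u, n) >> *~ i.+1 :> free.
      by rewrite freegU_mulz intz.
    rewrite NegzE -freegUN !mulz quot_piN !quot_piMz.
    by rewrite -/(tens _ _) -/(tens (- m) n) tensNl mulNrz.
  exact: KP.
rewrite -[x]freeg_sumE raddf_sum /=; elim/big_ind: _ => //= y _; exact: Kk.
Qed.

End TensorTheory.

(* tlift f is evaluated on a representative; it is well defined and additive
   when f is balanced (tlift_tens, tliftD), and has no meaning otherwise. *)
Definition tlift (S : pzRingType) (M N : bimodType S) (Q : zmodType)
    (f : M -> N -> Q) (t : tensor M N) : Q :=
  fglift (fun mn : M * N => f mn.1 mn.2 : zmodule Q) (repr t).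

Definition balanced (S : pzRingType) (M N : bimodType S) (Q : zmodType)
    (f : M -> N -> Q) : Prop :=
  [/\ forall n, {morph f^~ n : m m' / m + m'},
      forall m, {morph f m : n n' / n + n'} &
      forall m s n, f (ract m s) n = f m (s *: n)].

Section TensorLift.
Variables (S : pzRingType) (M N : bimodType S) (Q : zmodType) (f : M -> N -> Q).
Hypothesis hf : balanced f.
Local Notation free := {freeg (M * N)%type / int}.
Let F : free -> Q := fglift (fun mn : M * N => f mn.1 mn.2 : zmodule Q).

Let FB (x y : free) : F (x - y) = F x - F y.
Proof. exact: (lift_is_additive (fun mn : M * N => f mn.1 mn.2 : zmodule Q)). Qed.

Let F1 m n : F << (m, n) >> = f m n.
Proof. by rewrite /F liftU. Qed.

Let F_pi (x : free) : tlift f (\pi x) = F x.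
Proof.
rewrite /tlift -/F; apply/eqP; rewrite -subr_eq0 -FB; apply/eqP.
have /quot_eqP/asboolP := reprK (\pi_(tensor M N) x).
set z := _ - x => /(_ [set z | F z = 0]); apply.
  split=> /= [|a b ha hb]; last by rewrite FB ha hb subrr.
  by rewrite -[0]/(0 : free) -(subrr (0 : free)) FB subrr.
case: hf => hl hr hb.
move=> /= w [[m [m' [n ->]]]|[m [n [n' ->]]]|[m [s [n ->]]]];
  rewrite !FB !F1 ?hl ?hr ?hb ?subrr //.
all: by rewrite addrAC addrK subrr.
Qed.

Lemma tlift_tens m n : tlift f (tens m n) = f m n.
Proof. by rewrite F_pi F1. Qed.

Lemma tliftB : {morph tlift f : x y / x - y}.
Proof. by elim/quotW=> x; elim/quotW => y; rewrite -quot_piB !F_pi FB. Qed.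

Lemma tliftD : {morph tlift f : x y / x + y}.
Proof.
move=> x y; rewrite -[in LHS](opprK y) tliftB -[- y]sub0r tliftB.
by rewrite -(subrr 0) tliftB subrr sub0r opprK.
Qed.

End TensorLift.

Section TensorBimodule.
Variables (S : pzRingType) (M N : bimodType S).
Local Notation MN := (tensor M N).

Definition tens_scale (s : S) : MN -> MN := tlift (fun m n => tens (s *: m) n).
Definition tens_ractr (t : MN) (s : S) : MN :=
  tlift (fun m n => tens m (ract n s)) t.

Lemma scale_ractC (L : bimodType S) s (v : L) t :
  ract (s *: v) t = s *: ract v t.
Proof. exact: lractA. Qed.

Fact tens_scale_balanced s : balanced (fun (m : M) (n : N) => tens (s *: m) n).
Proof.
split=> [n m m'|m n n'|m r n]; first by rewrite scalerDr tensDl.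
  by rewrite tensDr.
by rewrite -lractA tens_ract.
Qed.

Fact tens_ract_balanced s : balanced (fun (m : M) (n : N) => tens m (ract n s)).
Proof.
split=> [n m m'|m n n'|m r n]; first by rewrite tensDl.
  by rewrite ractDl tensDr.
by rewrite tens_ract lractA.
Qed.

Let scD s := tliftD (tens_scale_balanced s).
Let rcD s := tliftD (tens_ract_balanced s).
Let sc1 s m n : tens_scale s (tens m n) = tens (s *: m) n.
Proof. exact/tlift_tens/tens_scale_balanced. Qed.
Let rc1 s m n : tens_ractr (tens m n) s = tens m (ract n s).
Proof. exact/tlift_tens/tens_ract_balanced. Qed.

Fact tens_scaleA a b v : tens_scale a (tens_scale b v) = tens_scale (a * b) v.
Proof.
elim/tens_ind: v => [m n|x y hx hy]; first by rewrite !sc1 scalerA.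
by rewrite /tens_scale !scD -!/(tens_scale _ _) hx hy.
Qed.

Fact tens_scale1 : left_id 1 tens_scale.
Proof.
elim/tens_ind => [m n|x y hx hy]; first by rewrite sc1 scale1r.
by rewrite /tens_scale !scD -!/(tens_scale _ _) hx hy.
Qed.

Fact tens_scaleDr : right_distributive tens_scale +%R.
Proof. by move=> s x y; exact: scD. Qed.

Fact tens_scaleDl v : {morph tens_scale^~ v : a b / a + b}.
Proof.
move=> a b; elim/tens_ind: v => [m n|x y hx hy].
  by rewrite !sc1 scalerDl tensDl.
by rewrite /tens_scale !scD -!/(tens_scale _ _) hx hy addrACA.
Qed.

HB.instance Definition _ := GRing.Zmodule_isLmodule.Build S MN
  tens_scaleA tens_scale1 tens_scaleDr tens_scaleDl.

Fact tens_ractA v s t : tens_ractr (tens_ractr v s) t = tens_ractr v (s * t).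
Proof.
elim/tens_ind: v => [m n|x y hx hy]; first by rewrite !rc1 ractA.
by rewrite /tens_ractr !rcD -!/(tens_ractr _ _) hx hy.
Qed.

Fact tens_ract1 v : tens_ractr v 1 = v.
Proof.
elim/tens_ind: v => [m n|x y hx hy]; first by rewrite rc1 ractr1.
by rewrite /tens_ractr !rcD -!/(tens_ractr _ _) hx hy.
Qed.

Fact tens_ractDl s : {morph tens_ractr^~ s : v w / v + w}.
Proof. exact: rcD. Qed.

Fact tens_ractDr v : {morph tens_ractr v : s t / s + t}.
Proof.
move=> a b; elim/tens_ind: v => [m n|x y hx hy].
  by rewrite !rc1 ractDr tensDr.
by rewrite /tens_ractr !rcD -!/(tens_ractr _ _) hx hy addrACA.
Qed.

Fact tens_lractA (s : S) (v : MN) t :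
  tens_ractr (s *: v) t = s *: tens_ractr v t.
Proof.
rewrite -[s *: v]/(tens_scale s v) -[RHS]/(tens_scale s _).
elim/tens_ind: v => [m n|x y hx hy]; first by rewrite !(sc1, rc1).
have rD := tens_ractDl; have sD := tens_scaleDr s.
by rewrite sD rD hx hy -sD -rD.
Qed.

HB.instance Definition _ := @Lmodule_isBimodule.Build S MN
  tens_ractr tens_ractA tens_ract1 tens_ractDl tens_ractDr tens_lractA.

Lemma scale_tens s m n : s *: tens m n = tens (s *: m) n.
Proof. exact: sc1. Qed.

Lemma ract_tens s m n : ract (tens m n) s = tens m (ract n s).
Proof. exact: rc1. Qed.

End TensorBimodule.

Record dsum (G : nat -> zmodType) : Type := DSum {
  dcoef :> forall m : nat, G m;
  dsum_finite : exists N : nat, forall m, (N <= m)%N -> dcoef m = 0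
}.

HB.instance Definition _ G := gen_eqMixin (dsum G).
HB.instance Definition _ G := gen_choiceMixin (dsum G).

Section DirectSum.
Variable G : nat -> zmodType.
Implicit Types x y z : dsum G.

Lemma dsumP x y : (forall m, x m = y m) -> x = y.
Proof.
case: x y => [f hf] [g hg] /= e; have {}e : f = g by apply: functional_extensionality_dep.
by subst g; congr DSum; exact: Prop_irrelevance.
Qed.

Definition dbound x : nat := projT1 (cid (dsum_finite x)).

Lemma dboundP x m : (dbound x <= m)%N -> x m = 0.
Proof. exact: (projT2 (cid (dsum_finite x))). Qed.

Fact dzero_finite :
  exists N : nat, forall m, (N <= m)%N -> (fun m => 0 : G m) m = 0.
Proof. by exists 0%N. Qed.

Fact dopp_finite x :
  exists N : nat, forall m, (N <= m)%N -> (fun m => - x m) m = 0.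
Proof. by exists (dbound x) => m /dboundP ->; rewrite oppr0. Qed.

Fact dadd_finite x y :
  exists N : nat, forall m, (N <= m)%N -> (fun m => x m + y m) m = 0.
Proof.
exists (maxn (dbound x) (dbound y)) => m; rewrite geq_max => /andP[hx hy].
by rewrite !dboundP // addr0.
Qed.

Definition dzero : dsum G := DSum dzero_finite.
Definition dopp x : dsum G := DSum (dopp_finite x).
Definition dadd x y : dsum G := DSum (dadd_finite x y).

Fact daddA : associative dadd.
Proof. by move=> x y z; apply: dsumP => m /=; rewrite addrA. Qed.
Fact daddC : commutative dadd.
Proof. by move=> x y; apply: dsumP => m /=; rewrite addrC. Qed.
Fact dadd0 : left_id dzero dadd.
Proof. by move=> x; apply: dsumP => m /=; rewrite add0r. Qed.
Fact daddN : left_inverse dzero dopp dadd.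
Proof. by move=> x; apply: dsumP => m /=; rewrite addNr. Qed.

HB.instance Definition _ :=
  GRing.isZmodule.Build (dsum G) daddA daddC dadd0 daddN.

Lemma dsumD x y m : (x + y) m = x m + y m. Proof. by []. Qed.
Lemma dsumN x m : (- x) m = - x m. Proof. by []. Qed.
Lemma dsumB x y m : (x - y) m = x m - y m. Proof. by []. Qed.
Lemma dsum0 m : (0 : dsum G) m = 0. Proof. by []. Qed.

Lemma dsum_sum I (r : seq I) (P : pred I) (F : I -> dsum G) m :
  (\sum_(i <- r | P i) F i) m = \sum_(i <- r | P i) F i m.
Proof. by elim/big_rec2: _ => // i a b _ <-. Qed.

Definition dinj_coef (m : nat) (a : G m) (k : nat) : G k :=
  if m =P k is ReflectT e then ecast j (G j) e a else 0.

Fact dinj_finite m (a : G m) :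
  exists N : nat, forall k, (N <= k)%N -> dinj_coef a k = 0.
Proof.
exists m.+1 => k hk; rewrite /dinj_coef; case: eqP => // e.
by exfalso; move: hk; rewrite -e ltnn.
Qed.

Definition dinj (m : nat) (a : G m) : dsum G := DSum (dinj_finite a).

Lemma dinj_eq m (a : G m) : dinj a m = a.
Proof. by rewrite /= /dinj_coef; case: eqP => // e; rewrite eq_axiomK. Qed.

Lemma dinj_neq m (a : G m) k : m <> k -> dinj a k = 0.
Proof. by rewrite /= /dinj_coef; case: eqP. Qed.

#[global] Arguments dcoef : simpl never.

Lemma dinjD m : {morph @dinj m : a b / a + b}.
Proof.
move=> a b; apply: dsumP => k; rewrite dsumD.
have [<-|/eqP h] := eqVneq m k; first by rewrite !dinj_eq.
by rewrite !dinj_neq // addr0.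
Qed.

Lemma dinj0 m : dinj (0 : G m) = 0.
Proof. by apply: (addIr (dinj (0 : G m))); rewrite -dinjD !add0r. Qed.

Lemma dinjN m : {morph @dinj m : a / - a}.
Proof. by move=> a; apply: (addIr (dinj a)); rewrite -dinjD !addNr dinj0. Qed.

Lemma dinjB m : {morph @dinj m : a b / a - b}.
Proof. by move=> a b; rewrite dinjD dinjN. Qed.

Definition gtag m (a : G m) : {m : nat & G m} := existT _ m a.

Lemma dinj_gtag m n (a : G m) (b : G n) : gtag a = gtag b -> dinj a = dinj b.
Proof.
move=> e; have : dinj (tagged (gtag a)) = dinj (tagged (gtag b)) by rewrite e.
by [].
Qed.

Lemma big_nat_bound (Q : zmodType) (F : nat -> Q) N N' : (N <= N')%N ->
  (forall m, (N <= m)%N -> F m = 0) ->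
  \sum_(0 <= i < N') F i = \sum_(0 <= i < N) F i.
Proof.
move=> le h; rewrite (big_cat_nat (n := N)) //=.
by rewrite [X in _ + X]big_nat [X in _ + X]big1 ?addr0 // => i /andP[/h].
Qed.

Lemma dsum_decomp x N : (forall m, (N <= m)%N -> x m = 0) ->
  x = \sum_(0 <= i < N) dinj (x i).
Proof.
move=> h; apply: dsumP => k; rewrite dsum_sum.
have [hk|hk] := leqP N k.
  rewrite h // big_nat big1 // => i /andP[_ hi].
  by rewrite dinj_neq // => e; move: hi; rewrite e ltnNge hk.
rewrite (bigD1_seq k) ?mem_index_iota ?iota_uniq //= dinj_eq big1 ?addr0 //.
by move=> i /eqP hi; rewrite dinj_neq.
Qed.

Lemma dsum_ind (K : dsum G -> Prop) : (forall m a, K (@dinj m a)) ->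
  (forall x y, K x -> K y -> K (x + y)) -> forall x, K x.
Proof.
move=> K1 KD x; rewrite (dsum_decomp (@dboundP x)).
by apply: big_ind => //; rewrite -(dinj0 0).
Qed.

End DirectSum.

(* gtag equates elements of components whose degrees are equal only
   propositionally. *)
Record gradedMul (G : nat -> zmodType) := GradedMul {
  gmul : forall i j, G i -> G j -> G (i + j)%N;
  gone : G 0%N;
  gmulDl : forall i j (b : G j), {morph (@gmul i j)^~ b : x y / x + y};
  gmulDr : forall i j (a : G i), {morph @gmul i j a : x y / x + y};
  gmulA : forall i j k (a : G i) (b : G j) (c : G k),
    gtag (gmul a (gmul b c)) = gtag (gmul (gmul a b) c);
  gmul1g : forall i (a : G i), gtag (gmul gone a) = gtag a;
  gmulg1 : forall i (a : G i), gtag (gmul a gone) = gtag a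
}.

Definition gring (G : nat -> zmodType) (M : gradedMul G) : Type := dsum G.

Section GradedRing.
Variables (G : nat -> zmodType) (M : gradedMul G).
Local Notation A := (gring M).
Implicit Types x y z : A.

HB.instance Definition _ := GRing.Zmodule.on A.

Definition dmul (x y : dsum G) : dsum G :=
  \sum_(0 <= i < dbound x) \sum_(0 <= j < dbound y) dinj (gmul M (x i) (y j)).

Lemma gmul0g i j (b : G j) : gmul M (0 : G i) b = 0.
Proof. by apply: (addIr (gmul M 0 b)); rewrite -gmulDl !add0r. Qed.

Lemma gmulg0 i j (a : G i) : gmul M a (0 : G j) = 0.
Proof. by apply: (addIr (gmul M a 0)); rewrite -gmulDr !add0r. Qed.

Lemma dmulE (x y : dsum G) N N' :
  (forall m, (N <= m)%N -> x m = 0) -> (forall m, (N' <= m)%N -> y m = 0) ->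
  dmul x y = \sum_(0 <= i < N) \sum_(0 <= j < N') dinj (gmul M (x i) (y j)).
Proof.
have aux K K' L L' : (forall m, (K <= m)%N -> x m = 0) ->
    (forall m, (K' <= m)%N -> y m = 0) -> (K <= L)%N -> (K' <= L')%N ->
    \sum_(0 <= i < L) \sum_(0 <= j < L') dinj (gmul M (x i) (y j)) =
    \sum_(0 <= i < K) \sum_(0 <= j < K') dinj (gmul M (x i) (y j)).
  move=> hx hy le le'; rewrite (big_nat_bound le) => [|i hi].
    apply: eq_bigr => i _; apply: big_nat_bound => // j hj.
    by rewrite hy // gmulg0 dinj0.
  by rewrite big1 // => j _; rewrite hx // gmul0g dinj0.
move=> hx hy; rewrite /dmul.
rewrite -(aux _ _ (maxn (dbound x) N) (maxn (dbound y) N') (@dboundP _ x)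
  (@dboundP _ y)) ?leq_maxl //.
by apply: aux; rewrite ?leq_maxr.
Qed.

Lemma dmulDl : left_distributive dmul +%R.
Proof.
move=> x y z; pose N := maxn (dbound x) (dbound y).
have hx m : (N <= m)%N -> x m = 0 by rewrite geq_max => /andP[/dboundP].
have hy m : (N <= m)%N -> y m = 0 by rewrite geq_max => /andP[_ /dboundP].
have hxy m : (N <= m)%N -> (x + y) m = 0.
  by move=> h; rewrite dsumD hx // hy // addr0.
rewrite (dmulE hx (@dboundP _ z)) (dmulE hy (@dboundP _ z)).
rewrite (dmulE hxy (@dboundP _ z)) -big_split; apply: eq_bigr => i _.
rewrite -big_split; apply: eq_bigr => j _.
by rewrite dsumD gmulDl dinjD.
Qed.

Lemma dmulDr : right_distributive dmul +%R.
Proof.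
move=> z x y; pose N := maxn (dbound x) (dbound y).
have hx m : (N <= m)%N -> x m = 0 by rewrite geq_max => /andP[/dboundP].
have hy m : (N <= m)%N -> y m = 0 by rewrite geq_max => /andP[_ /dboundP].
have hxy m : (N <= m)%N -> (x + y) m = 0.
  by move=> h; rewrite dsumD hx // hy // addr0.
rewrite (dmulE (@dboundP _ z) hx) (dmulE (@dboundP _ z) hy).
rewrite (dmulE (@dboundP _ z) hxy) -big_split; apply: eq_bigr => i _.
rewrite -big_split; apply: eq_bigr => j _.
by rewrite dsumD gmulDr dinjD.
Qed.

Lemma dmul_dinj i j (a : G i) (b : G j) :
  dmul (dinj a) (dinj b) = dinj (gmul M a b).
Proof.
have h k (c : G k) m : (k.+1 <= m)%N -> dinj c m = 0.
  by move=> hm; rewrite dinj_neq // => e; move: hm; rewrite e ltnn.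
rewrite (dmulE (h _ a) (h _ b)) (bigD1_seq i) ?mem_index_iota ?iota_uniq //=.
rewrite (bigD1_seq j) ?mem_index_iota ?iota_uniq //=.
rewrite !dinj_eq.
rewrite big1 ?addr0 => [|k /eqP hk]; last first.
  by rewrite dinj_neq ?gmulg0 ?dinj0 //; exact/nesym.
rewrite big1 ?addr0 // => k /eqP hk; rewrite big1 // => l _.
by rewrite dinj_neq ?gmul0g ?dinj0 //; exact/nesym.
Qed.

Fact dmulA : associative dmul.
Proof.
move=> x y z; elim/dsum_ind: x => [i a|x x' hx hx']; last first.
  by rewrite !dmulDl hx hx'.
elim/dsum_ind: y => [j b|y y' hy hy']; last by rewrite !(dmulDl, dmulDr) hy hy'.
elim/dsum_ind: z => [k c|z z' hz hz']; last by rewrite !dmulDr hz hz'.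
by rewrite !dmul_dinj; apply: dinj_gtag; exact: gmulA.
Qed.

Fact dmul1x : left_id (dinj (gone M)) dmul.
Proof.
elim/dsum_ind => [i a|x x' hx hx']; last by rewrite dmulDr hx hx'.
by rewrite dmul_dinj; apply: dinj_gtag; exact: gmul1g.
Qed.

Fact dmulx1 : right_id (dinj (gone M)) dmul.
Proof.
elim/dsum_ind => [i a|x x' hx hx']; last by rewrite dmulDl hx hx'.
by rewrite dmul_dinj; apply: dinj_gtag; exact: gmulg1.
Qed.

HB.instance Definition _ := GRing.Zmodule_isPzRing.Build A
  dmulA dmul1x dmulx1 dmulDl dmulDr.

Definition hinj (m : nat) (a : G m) : A := dinj a.

Lemma hinjM i j (a : G i) (b : G j) : hinj a * hinj b = hinj (gmul M a b).
Proof. exact: dmul_dinj. Qed.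

Lemma gring1 : 1 = hinj (gone M) :> A. Proof. by []. Qed.

Definition gring_deg (m : nat) : set A := range (@hinj m).

End GradedRing.

Arguments gring_deg {G} M m _.

Section TensorRing.
Variables (S : pzRingType) (V : bimodType S).

(* V^{m+1} is V tensored with V^m, so V^1 is V tensored with S, which is
   canonically isomorphic to V. *)
Fixpoint tpow (m : nat) : bimodType S :=
  if m is m'.+1 then tensor V (tpow m') : bimodType S else S^o : bimodType S.

(* (v (x) x') y = v (x) (x' y): concatenation of tensors; 0 + j and i.+1 + j
   compute, so no cast is needed. *)
Fixpoint tmul (i j : nat) : tpow i -> tpow j -> tpow (i + j) :=
  match i return tpow i -> tpow j -> tpow (i + j) with
  | 0%N => fun (s : S) y => s *: y
  | i'.+1 => fun x y => tlift (fun (v : V) (x' : tpow i') => tens v (tmul x' y)) x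
  end.

Lemma tmul_linear i j :
  [/\ forall y : tpow j, {morph (@tmul i j)^~ y : x x' / x + x'},
      forall x : tpow i, {morph @tmul i j x : y y' / y + y'},
      forall s (x : tpow i) (y : tpow j), tmul (s *: x) y = s *: tmul x y &
      forall s (x : tpow i) (y : tpow j), tmul x (ract y s) = ract (tmul x y) s].
Proof.
elim: i => [|i [hDl hDr hs hr]] /=.
  split=> [y s s'|s y y'|s t y|s t y].
  - exact: scalerDl.
  - exact: scalerDr.
  - by rewrite scalerA.
  - by rewrite lractA.
have bal (y : tpow j) : balanced (fun (v : V) (x' : tpow i) => tens v (tmul x' y)).
  split=> [n m m'|m n n'|m s n]; first exact: tensDl.
    by rewrite hDl tensDr.
  by rewrite tens_ract hs.
split=> [y x x'|x y y'|s x y|s x y]; first exact: (tliftD (bal y) x x').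
- elim/tens_ind: x => [v x|x x' hx hx'].
    by rewrite !(tlift_tens (bal _)) hDr tensDr.
  by rewrite !(tliftD (bal _)) hx hx' addrACA.
- elim/tens_ind: x => [v x|x x' hx hx'].
    by rewrite scale_tens !(tlift_tens (bal _)) scale_tens.
  by rewrite scalerDr !(tliftD (bal _)) hx hx' scalerDr.
- elim/tens_ind: x => [v x|x x' hx hx'].
    by rewrite !(tlift_tens (bal _)) hr ract_tens.
  by rewrite !(tliftD (bal _)) hx hx' ractDl.
Qed.

Fact tmulDl i j (y : tpow j) : {morph (@tmul i j)^~ y : x x' / x + x'}.
Proof. by case: (tmul_linear i j). Qed.
Fact tmulDr i j (x : tpow i) : {morph @tmul i j x : y y' / y + y'}.
Proof. by case: (tmul_linear i j). Qed.
Lemma tmul_scale i j s (x : tpow i) (y : tpow j) : tmul (s *: x) y = s *: tmul x y.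
Proof. by case: (tmul_linear i j). Qed.
Lemma tmul_ract i j s (x : tpow i) (y : tpow j) :
  tmul x (ract y s) = ract (tmul x y) s.
Proof. by case: (tmul_linear i j). Qed.

Lemma tmul_tens i j v (x : tpow i) (y : tpow j) :
  tmul (tens v x : tpow i.+1) y = tens v (tmul x y) :> tpow (i + j).+1.
Proof.
apply: (@tlift_tens _ _ _ _ (fun (v : V) (x' : tpow i) => tens v (tmul x' y))).
split=> [n m m'|m n n'|m s n]; first exact: tensDl.
  by rewrite tmulDl tensDr.
by rewrite tens_ract tmul_scale.
Qed.

Local Notation cast e x := (ecast m (tpow m : Type) e x).

Lemma castD m n (e : m = n) (x y : tpow m) : cast e (x + y) = cast e x + cast e y.
Proof. by case: n / e. Qed.

Lemma cast_tens m n (e : m = n) (e' : m.+1 = n.+1) v (x : tpow m) :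
  cast e' (tens v x : tpow m.+1) = tens v (cast e x) :> tpow n.+1.
Proof. by case: n / e e' => e'; rewrite eq_axiomK. Qed.

Lemma tmul_castA i j k (e : (i + (j + k) = i + j + k)%N)
    (x : tpow i) (y : tpow j) (z : tpow k) :
  cast e (tmul x (tmul y z)) = tmul (tmul x y) z.
Proof.
elim: i e x => [|i IH] e x.
  by rewrite eq_axiomK /= tmul_scale.
have e' : (i + (j + k) = i + j + k)%N by rewrite addnA.
elim/tens_ind: x => [v x|x x' hx hx']; last by rewrite tmulDl castD hx hx' !tmulDl.
rewrite tmul_tens (cast_tens e') IH tmul_tens.
exact/esym/tmul_tens.
Qed.

Lemma tmul_cast1 i (e : i = (i + 0)%N) (x : tpow i) (s : S) :
  tmul x (s : tpow 0) = cast e (ract x s).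
Proof.
elim: i e x => [|i IH] e x; first by rewrite eq_axiomK.
have e' : i = (i + 0)%N by rewrite addn0.
elim/tens_ind: x => [v x|x x' hx hx']; last by rewrite tmulDl ractDl castD hx hx'.
by rewrite tmul_tens ract_tens (cast_tens e') IH.
Qed.

Lemma gtag_cast m n (e : m = n) (x : tpow m) :
  gtag (G := fun m => tpow m : zmodType) (cast e x) =
  gtag (G := fun m => tpow m : zmodType) x.
Proof. by case: n / e. Qed.

Definition tpow_gradedMul : gradedMul (fun m => tpow m : zmodType).
Proof.
refine (@GradedMul (fun m => tpow m : zmodType) (fun i j => @tmul i j)
  (1 : S) tmulDl tmulDr _ _ _).
- move=> i j k x y z.
  by rewrite -(tmul_castA (addnA i j k)) gtag_cast.
- by move=> i x; rewrite /= scale1r.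
- move=> i x; rewrite (tmul_cast1 (esym (addn0 i))) ractr1.
  by rewrite gtag_cast.
Defined.

Definition tensor_ring : Type := gring tpow_gradedMul.
Local Notation T := tensor_ring.

HB.instance Definition _ := GRing.PzRing.on T.

Definition homog (m : nat) (a : tpow m) : T := hinj tpow_gradedMul a.

Definition tunit (s : S) : T := homog (s : tpow 0).

Fact tunit_zmod : zmod_morphism tunit.
Proof. by move=> s t; exact: (@dinjB (fun m => tpow m : zmodType) 0%N). Qed.
Fact tunit_monoid : monoid_morphism tunit.
Proof. by split=> // s t; rewrite /tunit /homog [RHS]hinjM. Qed.

HB.instance Definition _ := GRing.isZmodMorphism.Build S T tunit tunit_zmod.
HB.instance Definition _ := GRing.isMonoidMorphism.Build S T tunit tunit_monoid.

Fact tscale_finite (s : S) (x : T) :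
  exists N : nat, forall m, (N <= m)%N -> s *: dcoef x m = 0.
Proof. by exists (dbound x) => m /dboundP ->; rewrite scaler0. Qed.

Lemma ract0 (M : bimodType S) (s : S) : ract (0 : M) s = 0.
Proof. by apply: (addIr (ract (0 : M) s)); rewrite -ractDl !add0r. Qed.

Fact tract_finite (x : T) (s : S) :
  exists N : nat, forall m, (N <= m)%N -> ract (dcoef x m : tpow m) s = 0.
Proof. by exists (dbound x) => m /dboundP ->; rewrite ract0. Qed.

Definition tscale (s : S) (x : T) : T := DSum (tscale_finite s x).
Definition tract (x : T) (s : S) : T := DSum (tract_finite x s).

Fact tscaleA a b (x : T) : tscale a (tscale b x) = tscale (a * b) x.
Proof. by apply: dsumP => m; rewrite /dcoef /= scalerA. Qed.
Fact tscale1 : left_id 1 tscale.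
Proof. by move=> x; apply: dsumP => m; rewrite /dcoef /= scale1r. Qed.
Fact tscaleDr : right_distributive tscale +%R.
Proof. by move=> s x y; apply: dsumP => m; rewrite /dcoef /= scalerDr. Qed.
Fact tscaleDl (x : T) : {morph tscale^~ x : a b / a + b}.
Proof. by move=> a b; apply: dsumP => m; rewrite /dcoef /= scalerDl. Qed.

HB.instance Definition _ := GRing.Zmodule_isLmodule.Build S T
  tscaleA tscale1 tscaleDr tscaleDl.

Fact tractA (x : T) s t : tract (tract x s) t = tract x (s * t).
Proof. by apply: dsumP => m; rewrite /dcoef /= ractA. Qed.
Fact tract1 (x : T) : tract x 1 = x.
Proof. by apply: dsumP => m; rewrite /dcoef /= ractr1. Qed.
Fact tractDl s : {morph tract^~ s : x y / x + y}.
Proof. by move=> x y; apply: dsumP => m; rewrite /dcoef /= ractDl. Qed.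
Fact tractDr (x : T) : {morph tract x : s t / s + t}.
Proof. by move=> s t; apply: dsumP => m; rewrite /dcoef /= ractDr. Qed.
Fact tlractA (s : S) (x : T) t : tract (s *: x) t = s *: tract x t.
Proof. by apply: dsumP => m; rewrite /dcoef /= lractA. Qed.

HB.instance Definition _ := @Lmodule_isBimodule.Build S T
  tract tractA tract1 tractDl tractDr tlractA.

Lemma homogD m (a b : tpow m) : homog (a + b) = homog a + homog b.
Proof. exact: (@dinjD (fun m => tpow m : zmodType)). Qed.

Lemma homogB m (a b : tpow m) : homog (a - b) = homog a - homog b.
Proof. exact: (@dinjB (fun m => tpow m : zmodType)). Qed.

Lemma homog0 m : homog (0 : tpow m) = 0.
Proof. exact: (@dinj0 (fun m => tpow m : zmodType)). Qed.

Lemma homogM i j (a : tpow i) (b : tpow j) :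
  homog a * homog b = homog (tmul a b).
Proof. exact: (hinjM tpow_gradedMul). Qed.

Lemma homog_ind (K : T -> Prop) : (forall m (a : tpow m), K (homog a)) ->
  (forall x y, K x -> K y -> K (x + y)) -> forall x, K x.
Proof. exact: (@dsum_ind (fun m => tpow m : zmodType)). Qed.

Lemma scale_homog m s (a : tpow m) : s *: homog a = homog (s *: a).
Proof.
apply: dsumP => k; rewrite -[LHS]/(s *: (dcoef (homog a) k : tpow k)).
have [<-|/eqP h] := eqVneq m k; first by rewrite !dinj_eq.
by rewrite !dinj_neq // scaler0.
Qed.

Lemma ract_homog m s (a : tpow m) : ract (homog a) s = homog (ract a s).
Proof.
apply: dsumP => k; rewrite -[LHS]/(ract (dcoef (homog a) k : tpow k) s).
have [<-|/eqP h] := eqVneq m k; first by rewrite !dinj_eq.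
by rewrite !dinj_neq // ract0.
Qed.

Lemma tscaleE (s : S) (x : T) : s *: x = tunit s * x.
Proof.
elim/homog_ind: x => [m a|x y hx hy]; last by rewrite scalerDr mulrDr hx hy.
by rewrite scale_homog homogM.
Qed.

Lemma tractE (x : T) (s : S) : ract x s = x * tunit s.
Proof.
elim/homog_ind: x => [m a|x y hx hy]; last by rewrite ractDl mulrDl hx hy.
rewrite ract_homog homogM; apply: dinj_gtag.
by rewrite (tmul_cast1 (esym (addn0 m))) gtag_cast.
Qed.

End TensorRing.

Definition two_sided_ideal (A : pzRingType) (I : set A) : Prop :=
  [/\ subgroup I, (forall a x, I x -> I (a * x)) &
                  (forall a x, I x -> I (x * a))].

Definition ideal_gen (A : pzRingType) (X : set A) : set A :=
  [set x | forall I, two_sided_ideal I -> X `<=` I -> I x].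

Definition ideal_pred (A : pzRingType) (X : set A) : pred A :=
  fun x => `[< ideal_gen X x >].

Section QuotientRing.
Variables (A : pzRingType) (X : set A).

Lemma ideal_gen_sub : X `<=` ideal_gen X.
Proof. by move=> x Xx I _; apply. Qed.

Lemma ideal_genP : two_sided_ideal (ideal_gen X).
Proof.
split; first split=> [|x y hx hy] I hI XI.
- by case: hI => -[h0 _] _ _.
- by case: (hI) => -[_ hB] _ _; apply: hB; [exact: hx | exact: hy].
- by move=> a x hx I hI XI; case: (hI) => _ hl _; apply: hl; exact: hx.
- by move=> a x hx I hI XI; case: (hI) => _ _ hr; apply: hr; exact: hx.
Qed.

Fact ideal_pred_closed : zmod_closed (ideal_pred X).
Proof.
case: ideal_genP => -[h0 hB] _ _.
split=> [|x y /asboolP hx /asboolP hy]; apply/asboolP => //; exact: hB.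
Qed.

HB.instance Definition _ := GRing.isZmodClosed.Build A (ideal_pred X)
  ideal_pred_closed.

Definition ideal_closed : zmodClosed A :=
  GRing.ZmodClosed.clone A (ideal_pred X) _.

Definition qring : Type := Quotient.quot ideal_closed.

HB.instance Definition _ := GRing.Zmodule.on qring.
HB.instance Definition _ := Quotient.on qring.

Definition qpi (x : A) : qring := \pi_qring x.

Lemma qpi_eq x y : qpi x = qpi y <-> ideal_gen X (x - y).
Proof. by split=> [/quot_eqP/asboolP|h] //; apply/quot_eqP/asboolP. Qed.

Lemma qpi_surj (u : qring) : exists x, u = qpi x.
Proof. by exists (repr u); rewrite /qpi reprK. Qed.

Lemma qpiD : {morph qpi : x y / x + y}. Proof. exact: quot_piD. Qed.

Definition qone : qring := qpi 1.
Definition qmul (u v : qring) : qring := qpi (repr u * repr v).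

Lemma qmulE x y : qmul (qpi x) (qpi y) = qpi (x * y).
Proof.
case: ideal_genP => -[_ hB] hl hr; apply/qpi_eq.
have r (z : A) : ideal_gen X (repr (qpi z) - z) by apply/qpi_eq; rewrite /qpi reprK.
set a := repr _; set b := repr _.
have -> : a * b - x * y = (a - x) * b - x * (y - b).
  by rewrite mulrBl mulrBr opprB addrA subrK.
apply: (hB); [by apply: hr; exact: r | apply: hl].
have -> : y - b = 0 - (b - y) by rewrite sub0r opprB.
by apply: hB; [case: ideal_genP => -[] h0 _ _ _ | exact: r].
Qed.

Fact qmulA : associative qmul.
Proof.
move=> u v w; have [x ->] := qpi_surj u; have [y ->] := qpi_surj v.
by have [z ->] := qpi_surj w; rewrite !qmulE mulrA.
Qed.
Fact qmul1l : left_id qone qmul.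
Proof. by move=> u; have [x ->] := qpi_surj u; rewrite qmulE mul1r. Qed.
Fact qmul1r : right_id qone qmul.
Proof. by move=> u; have [x ->] := qpi_surj u; rewrite qmulE mulr1. Qed.
Fact qmulDl : left_distributive qmul +%R.
Proof.
move=> u v w; have [x ->] := qpi_surj u; have [y ->] := qpi_surj v.
by have [z ->] := qpi_surj w; rewrite -qpiD !qmulE mulrDl qpiD.
Qed.
Fact qmulDr : right_distributive qmul +%R.
Proof.
move=> u v w; have [x ->] := qpi_surj u; have [y ->] := qpi_surj v.
by have [z ->] := qpi_surj w; rewrite -qpiD !qmulE mulrDr qpiD.
Qed.

HB.instance Definition _ := GRing.Zmodule_isPzRing.Build qring
  qmulA qmul1l qmul1r qmulDl qmulDr.

Fact qpi_zmod : zmod_morphism qpi.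
Proof. exact: quot_piB. Qed.
Fact qpi_monoid : monoid_morphism qpi.
Proof. by split=> // x y; rewrite -qmulE. Qed.

HB.instance Definition _ := GRing.isZmodMorphism.Build A qring qpi qpi_zmod.
HB.instance Definition _ := GRing.isMonoidMorphism.Build A qring qpi qpi_monoid.

End QuotientRing.

Record filtration (U : pzRingType) := Filtration {
  fil :> nat -> set U;
  fil_subgroup : forall m, subgroup (fil m);
  fil_le : forall m, fil m `<=` fil m.+1;
  fil1 : fil 0%N 1;
  filM : forall i j x y, fil i x -> fil j y -> fil (i + j)%N (x * y)
}.

Definition fil_pred (U : pzRingType) (F : filtration U) (m : nat) : pred U :=
  fun x => `[< F m x >].

(* The step of index m - 1 of the filtration; the step of index -1 is 0. *)
Definition fil_prev (U : pzRingType) (F : filtration U) (m : nat) : set U :=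
  if m is m'.+1 then F m' else [set 0].

Section AssociatedGraded.
Variables (U : pzRingType) (F : filtration U).

Fact fil_pred_closed m : zmod_closed (fil_pred F m).
Proof.
case: (fil_subgroup F m) => h0 hB.
split=> [|x y /asboolP hx /asboolP hy]; apply/asboolP => //; exact: hB.
Qed.

HB.instance Definition _ m := GRing.isZmodClosed.Build U (fil_pred F m)
  (fil_pred_closed m).

Record fil_part (m : nat) := FilPart {
  fil_val :> U;
  fil_valP : fil_pred F m fil_val
}.

HB.instance Definition _ m := [isSub for @fil_val m].
HB.instance Definition _ m := [Choice of fil_part m by <:].
HB.instance Definition _ m := [SubChoice_isSubZmodule of fil_part m by <:].

Lemma fil_prev_subgroup m : subgroup (fil_prev F m).
Proof.
case: m => [|m] /=; last exact: fil_subgroup.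
by split=> // x y -> ->; rewrite /= subrr.
Qed.

Lemma fil_prev_sub m : fil_prev F m `<=` F m.
Proof.
case: m => [|m] /=; last exact: fil_le.
by move=> x ->; case: (fil_subgroup F 0).
Qed.

Lemma fil_prevMl i j x y : fil_prev F i x -> F j y -> fil_prev F (i + j) (x * y).
Proof.
case: i => [|i] /= hx hy; last exact: filM.
by rewrite hx mul0r; case: (fil_prev_subgroup j).
Qed.

Lemma fil_prevMr i j x y : F i x -> fil_prev F j y -> fil_prev F (i + j) (x * y).
Proof.
case: j => [|j] /= hx hy; last by rewrite addnS; exact: filM.
by rewrite hy mulr0; case: (fil_prev_subgroup (i + 0)).
Qed.

Definition fil_prev_pred (m : nat) : pred (fil_part m) :=
  fun x => `[< fil_prev F m (val x) >].

Fact fil_prev_zmod_closed m : zmod_closed (@fil_prev_pred m).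
Proof.
case: (fil_prev_subgroup m) => h0 hB.
split=> [|x y /asboolP hx /asboolP hy]; apply/asboolP; first by rewrite raddf0.
by rewrite raddfB; exact: hB.
Qed.

HB.instance Definition _ m := GRing.isZmodClosed.Build (fil_part m)
  (@fil_prev_pred m) (fil_prev_zmod_closed m).

Definition fil_prev_closed (m : nat) : zmodClosed (fil_part m) :=
  GRing.ZmodClosed.clone (fil_part m) (@fil_prev_pred m) _.

Definition gr_part (m : nat) : zmodType := Quotient.quot (fil_prev_closed m).

(* The class of u in the component of degree m; it has no meaning when u is
   not in F m. *)
Definition gr_class (m : nat) (u : U) : gr_part m :=
  \pi_(Quotient.quot (fil_prev_closed m)) (insubd (0 : fil_part m) u).

Lemma val_insubd_fil m u : F m u -> val (insubd (0 : fil_part m) u) = u.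
Proof. by move=> h; rewrite val_insubd ifT //; apply/asboolP. Qed.

Lemma gr_class_eq m u v : F m u -> F m v ->
  gr_class m u = gr_class m v <-> fil_prev F m (u - v).
Proof.
move=> hu hv; split=> [/quot_eqP/asboolP|h]; last apply/quot_eqP/asboolP;
  by rewrite raddfB /= !val_insubd_fil.
Qed.

Lemma gr_class_surj m (a : gr_part m) : exists2 u, F m u & a = gr_class m u.
Proof.
exists (val (repr a)); first by apply/asboolP; exact: valP (repr a).
by rewrite /gr_class valKd reprK.
Qed.

Lemma gr_classB m u v : F m u -> F m v ->
  gr_class m (u - v) = gr_class m u - gr_class m v.
Proof.
move=> hu hv; rewrite /gr_class -quot_piB; congr (\pi _); apply: val_inj.
rewrite raddfB /= !val_insubd_fil //; by case: (fil_subgroup F m) => _; apply.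
Qed.

Lemma gr_class0 m : gr_class m 0 = 0.
Proof. case: (fil_subgroup F m) => h0 _; have := gr_classB h0 h0.
by rewrite !subrr.
Qed.

Lemma filD m u v : F m u -> F m v -> F m (u + v).
Proof.
case: (fil_subgroup F m) => h0 hB hu hv.
by rewrite -[v]opprK -(sub0r v); do 2![apply: (hB) => //].
Qed.

Lemma gr_classD m u v : F m u -> F m v ->
  gr_class m (u + v) = gr_class m u + gr_class m v.
Proof.
move=> hu hv; apply: (addIr (- gr_class m v)); rewrite addrK -gr_classB ?addrK //.
exact: filD.
Qed.

Definition gr_mul (i j : nat) (a : gr_part i) (b : gr_part j) : gr_part (i + j) :=
  gr_class (i + j) (val (repr a) * val (repr b)).

Lemma gr_mulE i j u v : F i u -> F j v ->
  gr_mul (gr_class i u) (gr_class j v) = gr_class (i + j) (u * v).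
Proof.
move=> hu hv; rewrite /gr_mul; set a := val _; set b := val _.
have repr_class k w (hw : F k w) :
    F k (val (repr (gr_class k w))) /\ fil_prev F k (val (repr (gr_class k w)) - w).
  have h : F k (val (repr (gr_class k w))).
    by apply/asboolP; exact: valP (repr (gr_class k w)).
  by split=> //; apply/gr_class_eq => //; rewrite {1}/gr_class valKd reprK.
have [ha ea] := repr_class _ _ hu; have [hb eb] := repr_class _ _ hv.
apply/gr_class_eq; [exact: filM | exact: filM |].
have -> : a * b - u * v = (a - u) * b - u * (0 - (b - v)).
  by rewrite sub0r mulrN opprK mulrBl mulrBr addrA subrK.
case: (fil_prev_subgroup (i + j)) => h0 hB; apply: hB; first exact: fil_prevMl.
apply: fil_prevMr => //; case: (fil_prev_subgroup j) => h0' hB'.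
exact: hB'.
Qed.

Lemma gtag_class m n u : m = n ->
  gtag (G := gr_part) (gr_class m u) = gtag (G := gr_part) (gr_class n u).
Proof. by move=> ->. Qed.

Definition gr_gradedMul : gradedMul gr_part.
Proof.
refine (@GradedMul gr_part gr_mul (gr_class 0 1) _ _ _ _ _).
- move=> i j b x y; have [u hu ->] := gr_class_surj x.
  have [v hv ->] := gr_class_surj y; have [w hw ->] := gr_class_surj b.
  rewrite -gr_classD // !gr_mulE // ?mulrDl ?gr_classD //; try exact: filM.
  exact: filD.
- move=> i j b x y; have [u hu ->] := gr_class_surj x.
  have [v hv ->] := gr_class_surj y; have [w hw ->] := gr_class_surj b.
  rewrite -gr_classD // !gr_mulE // ?mulrDr ?gr_classD //; try exact: filM.
  exact: filD.
- move=> i j k a b c; have [u hu ->] := gr_class_surj a.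
  have [v hv ->] := gr_class_surj b; have [w hw ->] := gr_class_surj c.
  rewrite !gr_mulE //; try exact: filM.
  by rewrite mulrA; apply: gtag_class; rewrite addnA.
- move=> i a; have [u hu ->] := gr_class_surj a.
  rewrite gr_mulE ?mul1r //; exact: fil1.
- move=> i a; have [u hu ->] := gr_class_surj a.
  rewrite gr_mulE ?mulr1 //; last exact: fil1.
  by apply: gtag_class; rewrite addn0.
Defined.

Definition gr : Type := gring gr_gradedMul.

HB.instance Definition _ := GRing.PzRing.on gr.

End AssociatedGraded.

(* iA, iB are the structure maps from S; dA m, dB m are the sets of homogeneous
   elements of degree m. *)

Record graded_sring_morphism (S A B : pzRingType)
    (iA : S -> A) (dA : nat -> set A) (iB : S -> B) (dB : nat -> set B)
    (f : A -> B) : Prop := {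
  gsm_add : {morph f : x y / x + y};
  gsm_mul : {morph f : x y / x * y};
  gsm_unit : forall s, f (iA s) = iB s;
  gsm_deg : forall m x, dA m x -> dB m (f x)
}.

Definition graded_sring_isomorphism (S A B : pzRingType)
    (iA : S -> A) (dA : nat -> set A) (iB : S -> B) (dB : nat -> set B)
    (f : A -> B) : Prop :=
  graded_sring_morphism iA dA iB dB f /\ bijective f.

Section PBW.
Variables (S : pzRingType) (V : bimodType S).
Local Notation T := (tensor_ring V).
Implicit Types P R : set T.

Definition tproj (m : nat) (x : T) : tpow V m := dcoef x m.

Definition Tle (m : nat) : set T :=
  [set x | forall k, (m < k)%N -> tproj k x = 0].

Definition direct_sum (Rm : forall m, set (tpow V m)) : set T :=
  [set x | forall m, Rm m (tproj m x)].

(* lead_part P m is R_P^m and lead P is R_P. *)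
Definition lead_part P (m : nat) : set (tpow V m) := tproj m @` (P `&` Tle m).

Definition lead P : set T := direct_sum (lead_part P).

Definition concentrated (n : nat) (X : set (tpow V n)) : set T :=
  [set x | X (tproj n x) /\ forall m, m != n -> tproj m x = 0].

Definition top_part (n : nat) P : set T := concentrated (tproj n @` P).

Lemma tprojB m (x y : T) : tproj m (x - y) = tproj m x - tproj m y.
Proof. by []. Qed.
Lemma tprojD m (x y : T) : tproj m (x + y) = tproj m x + tproj m y.
Proof. by []. Qed.
Lemma tproj0 m : tproj m 0 = 0. Proof. by []. Qed.
Lemma tproj_homog m (a : tpow V m) : tproj m (homog a) = a.
Proof. exact: dinj_eq. Qed.
Lemma tproj_homog_neq m k (a : tpow V m) : m <> k -> tproj k (homog a) = 0.
Proof. exact: dinj_neq. Qed.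

Lemma Tle_subgroup m : subgroup (Tle m).
Proof. by split=> // x y hx hy k hk; rewrite tprojB hx // hy // subrr. Qed.

Lemma Tle_homog m (a : tpow V m) : Tle m (homog a).
Proof.
move=> k hk; rewrite tproj_homog_neq // => e.
by move: hk; rewrite e ltnn.
Qed.

Lemma Tle_leq m n : (m <= n)%N -> Tle m `<=` Tle n.
Proof. by move=> h x hx k hk; apply: hx; exact: leq_ltn_trans hk. Qed.

Lemma Tle_sum m (x : T) : Tle m x ->
  x = \sum_(0 <= i < m.+1) homog (tproj i x).
Proof. exact: (@dsum_decomp (fun m => tpow V m : zmodType)). Qed.

Lemma Tle_add m (x y : T) : Tle m x -> Tle m y -> Tle m (x + y).
Proof. by move=> hx hy k hk; rewrite tprojD hx // hy // addr0. Qed.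

Lemma TleM i j (x y : T) : Tle i x -> Tle j y -> Tle (i + j) (x * y).
Proof.
move=> hx hy; rewrite (Tle_sum hx) (Tle_sum hy) mulr_suml big_nat.
apply: (big_ind (Tle (i + j))) => [|a b|k]; [by [] | exact: Tle_add |].
move=> /andP[_ hk]; rewrite mulr_sumr big_nat.
apply: (big_ind (Tle (i + j))) => [|a b|l]; [by [] | exact: Tle_add |].
move=> /andP[_ hl]; rewrite homogM.
by apply: (@Tle_leq (k + l)%N); [exact: leq_add | exact: Tle_homog].
Qed.

Definition U_le P (m : nat) : set (qring P) := qpi P @` Tle m.

Definition U_filtration P : filtration (qring P).
Proof.
refine (@Filtration (qring P) (@U_le P) _ _ _ _).
- move=> m; have [h0 hB] := Tle_subgroup m; split; first by exists 0; rewrite ?raddf0.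
  by move=> _ _ [x hx <-] [y hy <-]; exists (x - y); rewrite ?raddfB //; exact: hB.
- by move=> m _ [x hx <-]; exists x => //; exact: Tle_leq hx.
- by exists 1; rewrite ?rmorph1 //; exact: (@Tle_homog 0 (1 : S)).
- move=> i j _ _ [x hx <-] [y hy <-]; exists (x * y); rewrite ?rmorphM //.
  exact: TleM.
Defined.

Definition grU P : pzRingType := gr (U_filtration P).

Definition qunit (X : set T) (s : S) : qring X := qpi X (tunit V s).
Definition qdeg (X : set T) (m : nat) : set (qring X) :=
  qpi X @` range (@homog S V m).

Definition grU_homog P (m : nat) (u : qring P) : grU P :=
  hinj (gr_gradedMul (U_filtration P)) (gr_class (U_filtration P) m u).
Definition grU_unit P (s : S) : grU P := @grU_homog P 0%N (qunit P s).
Definition grU_deg P (m : nat) : set (grU P) :=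
  gring_deg (gr_gradedMul (U_filtration P)) m.

Fact Phi_lift_finite P (x : T) : exists N : nat, forall m, (N <= m)%N ->
  gr_class (U_filtration P) m (qpi P (homog (tproj m x))) = 0.
Proof.
exists (dbound x) => m /dboundP h; rewrite /tproj h homog0 raddf0.
exact: gr_class0.
Qed.

Definition Phi_lift P (x : T) : grU P := DSum (Phi_lift_finite P x).

(* Phi is evaluated on a representative of its argument. For R included in
   lead P it is well defined and is the surjective morphism of graded S-rings
   x + <R> |-> (x + <P>) + U(P)^{<= m-1}, for x of degree m: see Phi_homog,
   Phi_morphism and Phi_surj. *)
Definition Phi P R (a : qring R) : grU P := Phi_lift P (repr a).

Definition PBW_deformation P R : Prop :=
  graded_sring_isomorphism (@qunit R) (@qdeg R) (@grU_unit P) (@grU_deg P)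
    (@Phi P R).

Definition PBW_type P : Prop := PBW_deformation P (lead P).

(* Only the values of alpha on R matter. The last field says that the component
   of degree zero of alpha is the inclusion of R in T. *)
Record filtered_morphism R (alpha : T -> T) : Prop := {
  fm_add : forall x y, R x -> R y -> alpha (x + y) = alpha x + alpha y;
  fm_scale : forall s x, R x -> alpha (s *: x) = s *: alpha x;
  fm_ract : forall s x, R x -> alpha (ract x s) = ract (alpha x) s;
  fm_filtered : forall m (a : tpow V m), R (homog a) -> Tle m (alpha (homog a));
  fm_incl : forall m (a : tpow V m),
    R (homog a) -> tproj m (alpha (homog a)) = a
}.

Section PhiTheory.
Variables P R : set T.
Local Notation F := (U_filtration P).
Local Notation hom m u := (hinj (gr_gradedMul F) (gr_class F m u)).

Lemma U_le_qpi m (x : T) : Tle m x -> F m (qpi P x).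
Proof. by exists x. Qed.

Let Uh m (a : tpow V m) : F m (qpi P (homog a)).
Proof. exact/U_le_qpi/Tle_homog. Qed.

Lemma Phi_liftB : {morph Phi_lift P : x y / x - y}.
Proof.
move=> x y; apply: dsumP => m; rewrite dsumB.
rewrite -[LHS]/(gr_class F m (qpi P (homog (tproj m (x - y))))).
by rewrite tprojB homogB raddfB gr_classB //; exact: Uh.
Qed.

Lemma Phi_lift0 : Phi_lift P 0 = 0.
Proof. by have := Phi_liftB 0 0; rewrite !subrr. Qed.

Lemma Phi_liftD : {morph Phi_lift P : x y / x + y}.
Proof.
move=> x y; rewrite -[in LHS](opprK y) Phi_liftB -[- y]sub0r Phi_liftB Phi_lift0.
by rewrite sub0r opprK.
Qed.

Lemma Phi_lift_homog m (a : tpow V m) :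
  Phi_lift P (homog a) = hom m (qpi P (homog a)).
Proof.
apply: dsumP => k.
rewrite -[LHS]/(gr_class F k (qpi P (homog (tproj k (homog a))))) /hinj.
have [<-|/eqP h] := eqVneq m k; first by rewrite dinj_eq tproj_homog.
by rewrite dinj_neq // tproj_homog_neq // homog0 raddf0 gr_class0.
Qed.

Lemma Phi_liftM : {morph Phi_lift P : x y / x * y}.
Proof.
move=> x y; elim/homog_ind: x => [i a|x x' hx hx']; last first.
  by rewrite mulrDl !Phi_liftD hx hx' mulrDl.
elim/homog_ind: y => [j b|y y' hy hy']; last by rewrite mulrDr !Phi_liftD hy hy' mulrDr.
rewrite homogM !Phi_lift_homog -homogM [RHS]hinjM rmorphM /=.
by rewrite gr_mulE //; exact: Uh.
Qed.

Lemma Phi_lift_lead x : lead P x -> Phi_lift P x = 0.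
Proof.
move=> hx; apply: dsumP => m.
rewrite -[LHS]/(gr_class F m (qpi P (homog (tproj m x)))) dsum0.
have [p [Pp hp] ep] := hx m.
have F0 : F m 0 by case: (fil_subgroup F m).
rewrite -(gr_class0 F m); apply/gr_class_eq; [exact: Uh | exact: F0 |].
rewrite subr0 -ep.
have -> : qpi P (homog (tproj m p)) = qpi P (homog (tproj m p) - p).
  by apply/qpi_eq; rewrite opprB addrC subrK; exact: ideal_gen_sub.
case: m hx hp ep F0 => [|m] _ hp _ F0 /=.
  have -> : homog (tproj 0 p) - p = 0.
    apply: dsumP => k; rewrite -[LHS]/(tproj k (homog (tproj 0 p) - p)) tprojB.
    case: k => [|k]; first by rewrite tproj_homog subrr.
    by rewrite tproj_homog_neq // hp // subrr.
  by rewrite raddf0.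
exists (homog (tproj m.+1 p) - p) => // k hk; rewrite tprojB.
have [<-|/eqP h] := eqVneq m.+1 k; first by rewrite tproj_homog subrr.
rewrite tproj_homog_neq // hp ?subrr //.
by rewrite ltn_neqAle hk andbT; exact/eqP.
Qed.

Hypothesis RP : R `<=` lead P.

Lemma Phi_qpi (x : T) : @Phi P R (qpi R x) = Phi_lift P x.
Proof.
have /qpi_eq h : qpi R (repr (qpi R x)) = qpi R x by rewrite /qpi reprK.
apply/eqP; rewrite -subr_eq0 -Phi_liftB; apply/eqP.
apply: (h [set z | Phi_lift P z = 0]) => [|z /RP]; last exact: Phi_lift_lead.
split=> [|a z /= hz|a z /= hz].
- by split=> /= [|y z hy hz]; rewrite ?Phi_lift0 ?Phi_liftB ?hy ?hz ?subrr.
- by rewrite Phi_liftM hz mulr0.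
- by rewrite Phi_liftM hz mul0r.
Qed.

Lemma Phi_homog m (a : tpow V m) :
  @Phi P R (qpi R (homog a)) = hom m (qpi P (homog a)).
Proof. by rewrite Phi_qpi Phi_lift_homog. Qed.

Lemma Phi_morphism : graded_sring_morphism (@qunit R) (@qdeg R)
  (@grU_unit P) (@grU_deg P) (@Phi P R).
Proof.
split=> [u v|u v|s|m _ [_ [a _ <-] <-]].
- have [x ->] := qpi_surj u; have [y ->] := qpi_surj v.
  by rewrite -raddfD !Phi_qpi Phi_liftD.
- have [x ->] := qpi_surj u; have [y ->] := qpi_surj v.
  by rewrite -rmorphM !Phi_qpi Phi_liftM.
- exact: Phi_homog.
- by rewrite Phi_homog; exists (gr_class F m (qpi P (homog a))).
Qed.

Lemma Phi_surj (z : grU P) : exists a, @Phi P R a = z.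
Proof.
suff [x <-] : exists x, Phi_lift P x = z by exists (qpi R x); exact: Phi_qpi.
move: z; apply: (@dsum_ind (gr_part F)) => [m a|z z' [x <-] [y <-]]; last first.
  by exists (x + y); rewrite Phi_liftD.
have [_ [x hx <-] ->] := gr_class_surj a.
exists (homog (tproj m x)); rewrite Phi_lift_homog; congr (hinj _ _).
apply/gr_class_eq; [exact: Uh | exact: U_le_qpi |].
rewrite -raddfB /=.
have h k : (m <= k)%N -> tproj k (homog (tproj m x) - x) = 0.
  rewrite leq_eqVlt => /predU1P[<-|hk]; first by rewrite tprojB tproj_homog subrr.
  rewrite tprojB tproj_homog_neq ?hx ?subrr // => e.
  by move: hk; rewrite e ltnn.
case: m {a hx} h => [|m] h /=; last by exists (homog (tproj m.+1 x) - x).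
have -> : homog (tproj 0 x) - x = 0 by apply: dsumP => k; exact: h.
by rewrite raddf0.
Qed.

End PhiTheory.

Lemma top_part_subbimodule n P : subbimodule P -> subbimodule (top_part n P).
Proof.
move=> [[P0 PB] Ps Pr]; split; first split.
- by split=> //; exists 0.
- move=> x y [[p Pp ep] hx] [[q Pq eq] hy]; split.
    by exists (p - q); [exact: PB | rewrite !tprojB ep eq].
  by move=> m hm; rewrite tprojB hx // hy // subrr.
- move=> s x [[p Pp ep] hx]; split.
    by exists (s *: p); [exact: Ps | rewrite -[LHS]/(s *: tproj n p) ep].
  by move=> m hm; rewrite -[LHS]/(s *: tproj m x) hx // scaler0.
- move=> s x [[p Pp ep] hx]; split.
    by exists (ract p s); [exact: Pr | rewrite -[LHS]/(ract (tproj n p) s) ep].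
  by move=> m hm; rewrite -[LHS]/(ract (tproj m x) s) hx // ract0.
Qed.

Lemma top_part_lead n P : subbimodule P -> P `<=` Tle n -> top_part n P `<=` lead P.
Proof.
move=> [[P0 _] _ _] hP x [[p Pp ep] hx] m.
have [->|hm] := eqVneq m n; first by exists p => //; split=> //; exact: hP.
by exists 0; rewrite ?hx.
Qed.

End PBW.

(* Main.v *)
Require Import Defs.
From mathcomp Require Import all_boot all_algebra.
From mathcomp Require Import boolp classical_sets.

Set Implicit Arguments.
Unset Strict Implicit.
Unset Printing Implicit Defensive.

Import GRing.Theory.
Local Open Scope ring_scope.
Local Open Scope classical_set_scope.

(** Both sides of the equivalence force [p^n] to be injective on [P], and then
    [lead P = top_part n P], so that the two conditions on [Phi] coincide.
    If [U(P)] is a PBW-deformation and [x] in [P] has no component of degree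
    [n], the leading form of [x] is in the kernel of [Phi_lift], hence in the
    ideal generated by elements of degree [n], although its degree is less than
    [n]; so [x = 0], and [alpha] is the inverse of [p^n : P -> R^n].
    Conversely, [p^n] is a left inverse of any filtered [alpha]. *)

Section TopPart.
Variables (S : pzRingType) (V : bimodType S).
Local Notation T := (tensor_ring V).
Implicit Types (x y : T) (P : set T).

(** Degrees are nonnegative and add under multiplication, so a factor of order at least [n] forces
    the product to have order at least [n]. *)
Lemma order_ge_ideal n :
  two_sided_ideal [set x : T | forall k, (k < n)%N -> tproj k x = 0].
Proof.
have step i m (a : tpow V i) (b : tpow V m) k : (k < n)%N ->
    (k < i \/ k < m)%N -> tproj k (homog a * homog b) = 0.
  move=> hk h; rewrite homogM tproj_homog_neq // => e.
  by case: h; rewrite -e ltnNge ?leq_addr ?leq_addl.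
(* An induction principle: [x] is the sum of its homogeneous components, and those below degree [n]
   vanish. *)
have sum0 (Q : T -> Prop) x : (forall k, (k < n)%N -> tproj k x = 0) -> Q 0 ->
    (forall y z, Q y -> Q z -> Q (y + z)) ->
    (forall i (b : tpow V i), (n <= i)%N -> Q (homog b)) -> Q x.
  move=> hx Q0 QD Qh.
  rewrite (dsum_decomp (@dboundP (fun m => tpow V m : zmodType) x)).
  apply: big_ind => // i _; have [/hx h|] := ltnP i n; last exact: Qh.
  by rewrite -[dinj _]/(homog (tproj i x)) h homog0.
(split; first split) => //= [x y hx hy k hk|a x hx k hk|a x hx k hk].
- by rewrite tprojB hx ?hy ?subrr.
- apply: (sum0 (fun y => tproj k (a * y) = 0) x hx).
  + by rewrite mulr0.
  + by move=> y z hy hz; rewrite mulrDr tprojD hy hz addr0.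
  + move=> i b hi; elim/homog_ind: a => [j a|a a' ha ha'].
      by apply: step => //; right; exact: leq_trans hi.
    by rewrite mulrDl tprojD ha ha' addr0.
- apply: (sum0 (fun y => tproj k (y * a) = 0) x hx).
  + by rewrite mul0r.
  + by move=> y z hy hz; rewrite mulrDl tprojD hy hz addr0.
  + move=> i b hi; elim/homog_ind: a => [j a|a a' ha ha'].
      by apply: step => //; left; exact: leq_trans hi.
    by rewrite mulrDr tprojD ha ha' addr0.
Qed.

Lemma ideal_gen_top_part n P k x :
  (k < n)%N -> ideal_gen (top_part n P) x -> tproj k x = 0.
Proof.
move=> hk hx; apply: (hx _ (order_ge_ideal n)) => // y [_ hy] i hi.
by apply: hy; rewrite neq_ltn hi.
Qed.

Lemma lead_leading_form P m x : P 0 -> P x -> Tle m x ->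
  lead P (homog (tproj m x)).
Proof.
move=> P0 Px hx k; have [<-|/eqP h] := eqVneq m k.
  by rewrite tproj_homog; exists x.
by rewrite tproj_homog_neq //; exists 0; rewrite ?tproj0.
Qed.

Lemma PBW_deformation_top_part_inj n P x : subbimodule P -> P `<=` Tle n ->
  PBW_deformation P (top_part n P) -> P x -> tproj n x = 0 -> x = 0.
Proof.
move=> hP hPn [_ /bij_inj Phi_inj] Px xn0.
have RP := top_part_lead hP hPn; have [[P0 _] _ _] := hP.
(* The bound [m] on the degree of [x] is strict. It starts at [n], thanks to [xn0], and each leading
   form shown to vanish lowers it by one. *)
suff H m : (m <= n)%N -> (forall k, (m <= k)%N -> tproj k x = 0) -> x = 0.
  apply: (H n) => // k; rewrite leq_eqVlt => /predU1P[<- //|].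
  exact: hPn.
elim: m => [_ hx|m IH hm hx]; first by apply: dsumP => k; exact: hx.
apply: IH => [|k]; first exact: ltnW.
rewrite leq_eqVlt => /predU1P[<-|]; last exact: hx.
(* Both classes have image 0 under the injective [Phi]. *)
have /qpi_eq : qpi (top_part n P) (homog (tproj m x)) = qpi (top_part n P) 0.
  apply: Phi_inj; rewrite !Phi_qpi // Phi_lift0 Phi_lift_lead //.
  exact: lead_leading_form.
rewrite subr0 => /(ideal_gen_top_part hm).
by rewrite tproj_homog.
Qed.

Lemma lead_top_part n P : subbimodule P -> P `<=` Tle n ->
  (forall x, P x -> tproj n x = 0 -> x = 0) -> lead P = top_part n P.
Proof.
move=> hP hPn inj; apply/seteqP; split; last exact: top_part_lead.
move=> x hx; split=> [|m hm].
  by have [p [Pp _] e] := hx n; exists p.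
have [p [Pp hp] <-] := hx m.
(* Above [n] the component of [p] vanishes since [P] lies in [Tle n]. Below [n], [p] has degree less
   than [n], so [inj] gives [p = 0]. *)
case: (ltngtP m n) hm => // hm _; last by rewrite (hPn _ Pp).
by rewrite (inj p Pp) ?tproj0 // hp.
Qed.

Lemma top_part_homog n P x : top_part n P x -> x = homog (tproj n x).
Proof.
move=> [_ hx]; apply: dsumP => k; rewrite -!/(tproj _ _).
have [->|h] := eqVneq k n; first by rewrite tproj_homog.
by rewrite hx // tproj_homog_neq //; apply/nesym/eqP.
Qed.

Lemma filtered_top_part_inj n P (alpha : T -> T) :
  subbimodule P -> filtered_morphism (top_part n P) alpha ->
  P = alpha @` top_part n P -> forall x, P x -> tproj n x = 0 -> x = 0.
Proof.
move=> hP fm eP x; rewrite {1}eP => -[r Rr <-].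
have er := top_part_homog Rr; rewrite er (fm_incl fm) -?er // => rn0.
(* Additivity of [alpha] is available only on [top_part n P], so deducing [alpha 0 = 0] requires 0
   to lie there. *)
have R0 : top_part n P 0 by case: (top_part_subbimodule n hP) => -[].
rewrite er rn0 homog0; apply: (addIr (alpha 0)).
by rewrite -(fm_add fm) // !add0r.
Qed.

Lemma filtered_section n P : subbimodule P -> P `<=` Tle n ->
  (forall x, P x -> tproj n x = 0 -> x = 0) ->
  exists2 alpha, filtered_morphism (top_part n P) alpha &
    P = alpha @` top_part n P.
Proof.
move=> hP hPn inj; have [[P0 PB] Ps Pr] := hP.
have [[_ RB] Rs Rr] := top_part_subbimodule n hP.
have PD x y : P x -> P y -> P (x + y).
  by move=> hx hy; rewrite -[y]opprK -(sub0r y); do 2![apply: (PB) => //].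
have uniqP x y : P x -> P y -> tproj n x = tproj n y -> x = y.
  move=> hx hy e; apply/eqP; rewrite -subr_eq0; apply/eqP.
  by apply: inj; [exact: PB | rewrite tprojB e subrr].
(* The default 0 is returned only when the [n]-th component of [x] is not attained on [P], which
   never happens on [top_part n P]. *)
pose alpha x : T := xget 0 [set p | P p /\ tproj n p = tproj n x].
have alphaP x : top_part n P x -> P (alpha x) /\ tproj n (alpha x) = tproj n x.
  by move=> [[p Pp e] _]; apply: (@xgetI _ 0 [set p | P p /\ tproj n p = tproj n x] p).
(* By uniqueness of preimages, each bimodule law for [alpha] reduces to checking that the expected
   value lies in [P] and has the right [n]-th component. *)
have alphaE x p : top_part n P x -> P p -> tproj n p = tproj n x -> alpha x = p.
  by move=> /alphaP[Pa ea] Pp e; apply: uniqP => //; rewrite ea e.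
have homog_top m (a : tpow V m) : top_part n P (homog a) -> m = n \/ a = 0.
  move=> [_ h]; case: (eqVneq m n) => [|hm]; first by left.
  by right; rewrite -(tproj_homog a) h.
have alpha0 : alpha 0 = 0 by apply: alphaE => //; split => //; exists 0.
exists alpha; first split.
- move=> x y hx hy; have [Px ex] := alphaP x hx; have [Py ey] := alphaP y hy.
  apply: alphaE; [|exact: PD|by rewrite !tprojD ex ey].
  by rewrite -[y]opprK -(sub0r y); apply: (RB) => //; apply: RB => //; split => //; exists 0.
- move=> s x hx; have [Px ex] := alphaP x hx.
  apply: alphaE; [exact: Rs|exact: Ps|].
  by rewrite -[LHS]/(s *: tproj n (alpha x)) ex.
- move=> s x hx; have [Px ex] := alphaP x hx.
  apply: alphaE; [exact: Rr|exact: Pr|].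
  by rewrite -[LHS]/(ract (tproj n (alpha x)) s) ex.
- move=> m a ha; have [e|->] := homog_top m a ha; last by rewrite homog0 alpha0.
  by subst m; apply: hPn; case: (alphaP _ ha).
- move=> m a ha; have [e|->] := homog_top m a ha; last by rewrite homog0 alpha0.
  by subst m; have [_ ->] := alphaP _ ha; rewrite tproj_homog.
apply/seteqP; split=> [p Pp|_ [x hx <-]]; last by case: (alphaP x hx).
have hp : top_part n P (homog (tproj n p)).
  split=> [|m hm]; first by rewrite tproj_homog; exists p.
  by rewrite tproj_homog_neq //; apply/nesym/eqP.
by exists (homog (tproj n p)) => //; apply: alphaE; rewrite ?tproj_homog.
Qed.

End TopPart.

Theorem corollary2p5 (S : pzRingType) (hS : von_neumann_regular S)
    (V : bimodType S) (n : nat) (P : set (tensor_ring V))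
    (hP : subbimodule P) (hPn : P `<=` Tle n) :
  PBW_deformation P (top_part n P) <->
  exists alpha : tensor_ring V -> tensor_ring V,
    [/\ filtered_morphism (top_part n P) alpha,
        P = alpha @` top_part n P
      & PBW_type P].
Proof.
split=> [hd|[alpha [fm eP]]]; last first.
  (* The goal still has [PBW_type P] as premise; the rewriting makes premise and conclusion agree
     and leaves only injectivity to prove. *)
  by rewrite /PBW_type (lead_top_part hP hPn) //; exact: filtered_top_part_inj fm eP.
have inj x := PBW_deformation_top_part_inj (x := x) hP hPn hd.
have [alpha fm eP] := filtered_section hP hPn inj.
by exists alpha; split=> //; rewrite /PBW_type (lead_top_part hP hPn inj).
Qed.
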